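(* Let $\alpha>\beta>1$, let $I\subset\mathbb{R}$ be a closed interval of length $L\in(0,1)$, and let $F_{\alpha,\beta}\subset I$ be the compact set constructed from these data as described in the context. Then the Assouad spectrum $\theta\mapsto\dim_{\mathrm A}^{\theta}F_{\alpha,\beta}$ and the lower spectrum $\theta\mapsto\dim_{\mathrm L}^{\theta}F_{\alpha,\beta}$ (on $(0,1)$) each have the following properties: (1) they are not monotonic and, moreover, there are infinitely many disjoint intervals within which they fail to be monotonic; (2) they have infinitely many points of non-differentiability.
   Context: Construction of $F_{\alpha,\beta}$. First step: inside the interval $I$ of length $L$, pack closed intervals of length $L^{\alpha}$ with gaps of length $L^{\beta}$ between consecutive ones, using an optimal (i.e. maximal possible) number of such intervals; the particular way of packing does not matter as long as the number is optimal. Let $I_1$ be the union of these intervals. $k$th step ($k\geq2$): inside each interval of length $L^{\alpha^{k-1}}$ appearing at the $(k-1)$th step, optimally pack closed intervals of length $L^{\alpha^{k}}$ with gaps of length $L^{\alpha^{k-1}\beta}$, and let $I_k$ be the union of all these intervals of length $L^{\alpha^k}$. This gives a nested sequence of compact sets $I\supset I_1\supset I_2\supset\cdots$, and $F_{\alpha,\beta}=\bigcap_{k\geq1}I_k$. For a subset $E$ of a metric space and $r>0$, $N(E,r)$ denotes the minimal number of balls of radius $r$ required to cover $E$, and $B(x,R)$ is the ball of radius $R$ centred at $x$. For $\theta\in(0,1)$, the Assouad spectrum of $F$ at $\theta$ is \[ \dim_{\mathrm A}^{\theta} F = \inf\Big\{s : \exists C>0,\ \exists \rho>0,\ \forall\,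 0<R\leq\rho,\ \forall x\in F,\ N(B(x,R)\cap F,R^{1/\theta})\leq C \big(R/R^{1/\theta}\big)^{s}\Big\}, \] and the lower spectrum is \[ \dim_{\mathrm L}^{\theta} F = \sup\Big\{s : \exists C>0,\ \exists \rho>0,\ \forall\, 0<R\leq\rho,\ \forall x\in F,\ N(B(x,R)\cap F,R^{1/\theta})\geq C \big(R/R^{1/\theta}\big)^{s}\Big\}. \] *)

(* Defs.v *)
From HB Require Import structures.
From mathcomp Require Import all_boot all_order all_algebra.
From mathcomp Require Import all_classical all_reals all_analysis.
Set Implicit Arguments.
Unset Strict Implicit.
Unset Printing Implicit Defensive.
Import Order.TTheory GRing.Theory Num.Theory numFieldNormedType.Exports.
Local Open Scope classical_set_scope.
Local Open Scope ring_scope.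

(** ** Assouad and lower spectra *)

(* Extended-real valued: [+oo] when no finite cover exists. *)
Definition covering_number (R : realType) (T : pseudoMetricType R)
    (E : set T) (r : R) : \bar R :=
  ereal_inf [set n%:R%:E | n in
    [set n : nat | exists c : 'I_n -> T, E `<=` \bigcup_i ball (c i) r]].

(* For nonempty bounded [F] in the real line and [0 < theta < 1], the sets of
   exponents below are nonempty and bounded on the relevant side, so the
   default value 0 of [inf] and [sup] does not interfere. *)
Definition assouad_spectrum (R : realType) (T : pseudoMetricType R)
    (F : set T) (theta : R) : R :=
  inf [set s : R | exists C : R, exists rho : R, [/\ 0 < C, 0 < rho &
    forall (r : R) (x : T), 0 < r <= rho -> F x ->
      (covering_number (ball x r `&` F) (r `^ theta^-1)
        <= (C * (r / r `^ theta^-1) `^ s)%:E)%E]].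

Definition lower_spectrum (R : realType) (T : pseudoMetricType R)
    (F : set T) (theta : R) : R :=
  sup [set s : R | exists C : R, exists rho : R, [/\ 0 < C, 0 < rho &
    forall (r : R) (x : T), 0 < r <= rho -> F x ->
      (covering_number (ball x r `&` F) (r `^ theta^-1)
        >= (C * (r / r `^ theta^-1) `^ s)%:E)%E]].

(** ** The sets F_{alpha,beta} *)

(* A packing is encoded by the increasing list of the left endpoints of the
   packed intervals [x, x + len]; consecutive ones are exactly [gap] apart. *)
Definition packing (R : realType) (a l len gap : R) (s : seq R) : Prop :=
  sorted [rel x y | y == x + len + gap] s /\
  {in s, forall x, `[x, x + len]%classic `<=` `[a, a + l]}.

Definition optimal_packing (R : realType) (a l len gap : R) (s : seq R) : Prop :=
  packing a l len gap s /\
  forall s' : seq R, packing a l len gap s' -> (size s' <= size s)%N.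

(* [pack k x] lists the left endpoints of the intervals packed, at step k.+1,
   inside the interval of step k with left endpoint x (step 0 is I itself). *)
Fixpoint endpoints (R : realType) (a : R) (pack : nat -> R -> seq R) (k : nat) :
    set R :=
  if k is k'.+1
  then \bigcup_(x in endpoints a pack k') [set y | y \in pack k' x]
  else [set a].

Definition step_set (R : realType) (alpha L a : R) (pack : nat -> R -> seq R)
    (k : nat) : set R :=
  \bigcup_(x in endpoints a pack k) `[x, x + L `^ (alpha ^+ k)]%classic.

(* [F] is one of the sets F_{alpha,beta} built in I = [a, a + L]; the way of
   packing is a free choice in each interval, subject to optimality. *)
Definition is_F_alpha_beta (R : realType) (alpha beta L a : R) (F : set R) :
    Prop :=
  exists pack : nat -> R -> seq R,
    (forall k x, endpoints a pack k x ->
       optimal_packing x (L `^ (alpha ^+ k)) (L `^ (alpha ^+ k.+1))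
         (L `^ (alpha ^+ k * beta)) (pack k x)) /\
    F = \bigcap_k step_set alpha L a pack k.+1.

(** ** Monotonicity on an interval *)

Definition monotonic_on (R : realType) (J : interval R) (f : R -> R) : Prop :=
  {in J &, {homo f : x y / x <= y}} \/ {in J &, {homo f : x y /~ x <= y}}.

(* Main.v *)
Require Import Defs.
From HB Require Import structures.
From mathcomp Require Import all_boot all_order all_algebra.
From mathcomp Require Import all_classical all_reals all_analysis.
From mathcomp Require Import ring lra zify.
Import Order.TTheory GRing.Theory Num.Theory numFieldNormedType.Exports.
Local Open Scope classical_set_scope.
Local Open Scope ring_scope.

(** Write scales as powers [L `^ t].  Between the scales [t = alpha ^+ k] and
    [t = beta * alpha ^+ k] an interval of step [k] looks like a full interval;
    between [beta * alpha ^+ k] and [alpha ^+ k.+1] it looks like finitely many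
    points.  So, up to constants, a ball of radius [L `^ t] centred in the set
    needs [L `^ (h t - h u)] balls of radius [L `^ u], where [h], here
    [log_count], has slope 1 on the first kind of range and slope 0 on the
    second.  This is the content of [covering_number_le_profile] and
    [covering_number_ge_profile].  The pieces of each step are separated, so an
    elementary count gives both: separated pieces met by a ball are few, and a
    pigeonhole argument turns many pieces into many covering balls.

    For exponents, the Assouad and lower spectra at [theta] are therefore the
    upper and lower limits of [(h u - h t) / (u - t)] with [u = t / theta].  The
    function [h] is self-similar, [h (alpha * t) = alpha * h t], and [h t / t]
    oscillates between [b = (beta - 1) / (alpha - 1)], attained at the powers of
    [alpha], and [B = b * alpha / beta], attained at [beta] times these powers.

    If [theta = alpha ^- n], the quotient is just [h t / t], and the two spectra
    equal [B] and [b].  If [theta] is close to [alpha ^- n] but different,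
    choose [u] where [h u = B * u].  Then [t] is not such a point, so
    [h t < B * t] and the quotient exceeds [B]; since [h] is piecewise linear
    the excess is at least a constant times the distance from [theta] to
    [alpha ^- n].  Thus the Assouad spectrum has a cusp pointing downwards at
    every [alpha ^- n] ([assouad_exponents_cusp]).  Choosing [u] with
    [h u = b * u] shows in the same way that the lower spectrum has a cusp
    pointing upwards there ([lower_exponents_cusp]).  A cusp is a strict local
    extremum at which the function is not differentiable, and the points
    [alpha ^- n] have disjoint neighbourhoods
    ([geometric_cusps_irregular]). *)

Set Implicit Arguments.
Unset Strict Implicit.
Unset Printing Implicit Defensive.

(** * Covering numbers of unions of separated intervals *)

Section CoveringNumber.
Variable R : realType.
Implicit Types (E : set R) (s : seq R).

Lemma covering_number_le_size E (r : R) (cs : seq R) :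
  (forall z, E z -> exists2 c, c \in cs & ball c r z) ->
  (covering_number E r <= (size cs)%:R%:E)%E.
Proof.
move=> cov; apply: ge_ereal_inf; exists (size cs)%:R%:E => //.
exists (size cs) => //; exists (fun i => cs`_i) => z /cov[c cs_c cz].
have ic : (index c cs < size cs)%N by rewrite index_mem.
by exists (Ordinal ic) => //=; rewrite nth_index.
Qed.

Lemma le_covering_number E (r v : R) :
  (forall n (c : 'I_n -> R), E `<=` \bigcup_i ball (c i) r -> v <= n%:R) ->
  (v%:E <= covering_number E r)%E.
Proof.
move=> lb; apply: le_ereal_inf_tmp => _ [n [c cov] <-].
by rewrite lee_fin; exact: lb cov.
Qed.

Definition separated (D : R) s := {in s &, forall x y, x < y -> x + D <= y}.

Lemma sorted_separated_last (D x : R) s :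
  path <%O x s -> separated D (x :: s) -> x + (size s)%:R * D <= last x s.
Proof.
elim: s x => [|y s IHs] x /=; first by rewrite mul0r addr0.
move=> /andP[xy ys] sep.
have sep' : separated D (y :: s).
  by move=> u v us vs; apply: sep; rewrite in_cons ?us ?vs orbT.
have := IHs y ys sep'; have : x + D <= y by rewrite sep ?in_cons ?eqxx ?orbT.
by rewrite [(size s).+1%:R]mulrS mulrDl mul1r; lra.
Qed.

Lemma size_separated (D lo w : R) s : 0 <= D -> 0 <= w -> uniq s ->
  separated D s -> {in s, forall x, lo <= x <= lo + w} ->
  (size s)%:R * D <= w + D.
Proof.
move=> D0 w0 s_uniq sep box.
have pS : perm_eq (sort <=%O s) s by rewrite perm_sort.
have mS : sort <=%O s =i s by apply: perm_mem.
have : sorted <%O (sort <=%O s).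
  by rewrite lt_sorted_uniq_le sort_le_sorted sort_uniq s_uniq.
rewrite -(perm_size pS); case: (sort _ s) mS => [|x t] mS /=.
  by rewrite mul0r addr_ge0.
move=> xt.
have sep' : separated D (x :: t) by move=> u v; rewrite !mS; exact: sep.
have := sorted_separated_last xt sep'.
have := box x; have := box (last x t).
rewrite -!mS mem_last mem_head => /(_ isT)/andP[_ b1] /(_ isT)/andP[b2 _].
by rewrite [(size t).+1%:R]mulrS mulrDl mul1r; lra.
Qed.

(** Left endpoints of intervals that meet a ball of radius [r] fill a window of
    width [2 * r + len], in which points [len + g] apart are counted.  This one
    count bounds the number of pieces near a point of the set from above, and
    the number of pieces that a covering ball can use up. *)
Lemma size_separated_meet_ball (c r len g : R) s :
  0 <= r -> 0 <= len -> 0 < g -> uniq s -> separated (len + g) s ->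
  {in s, forall y, exists2 z, y <= z <= y + len & ball c r z} ->
  (size s)%:R <= 2 + 2 * (r / g).
Proof.
move=> r0 len0 g0 us sep meet.
have := @size_separated (len + g) (c - r - len) (2 * r + len) s.
have -> : 2 * r + len + (len + g) = (2 + (2 * r - g) / (len + g)) * (len + g).
  by field; lra.
rewrite ler_pM2r; last lra.
move=> /(_ _ _ us sep) le; apply: (@le_trans _ _ (2 + (2 * r - g) / (len + g))).
  apply: le => [||y /meet[z /andP[yz zy]]]; [lra|lra|].
  by rewrite -ball_normE /= ltr_norml => /andP[h1 h2]; lra.
rewrite lerD2l ler_pdivrMr; last lra.
rewrite mulrA (mulrAC _ g^-1) ler_pdivlMr //.
nra.
Qed.

(** The intervals are cut into [p] cells of length at most [r], and the ball of
    radius [r] about the middle of a cell contains the closed cell. *)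
Lemma covering_number_tiled (p : nat) (r len : R) E s :
  (0 < p)%N -> 0 < r -> len <= p%:R * r ->
  (forall z, E z -> exists2 y, y \in s & y <= z <= y + len) ->
  (covering_number E r <= ((size s)%:R * p%:R)%:E)%E.
Proof.
move=> p0 r0 lenp cov.
have := @covering_number_le_size E r
  [seq y + (i%:R + 2^-1) * r | y <- s, i <- iota 0 p].
rewrite size_allpairs size_iota natrM; apply.
move=> z /cov[y sy /andP[yz zy]].
have zr : (z - y) = (z - y) / r * r by rewrite divfK ?gt_eqF.
have q0 : 0 <= (z - y) / r by rewrite divr_ge0 ?subr_ge0 // ltW.
have qp : (z - y) / r <= p%:R by rewrite ler_pdivrMr //; lra.
have /andP[t1 t2] := truncn_itv q0.
(* The right endpoint of an interval may have quotient [p]; it belongs to the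
   last cell. *)
pose i := minn (Num.truncn ((z - y) / r)) p.-1.
have ip : (i < p)%N by rewrite -(prednK p0) ltnS geq_minr.
exists (y + (i%:R + 2^-1) * r).
  by apply/allpairsP; exists (y, i); rewrite /= mem_iota.
have [h1 h2] : i%:R <= (z - y) / r /\ (z - y) / r <= i%:R + 1.
  rewrite /i /minn; case: ltnP => hp; rewrite -natr1 in t2; first by split; lra.
  have : p.-1%:R <= (Num.truncn ((z - y) / r))%:R :> R by rewrite ler_nat.
  have : p.-1%:R + 1 = p%:R :> R by rewrite natr1 prednK.
  by split; lra.
rewrite -ball_normE /= ltr_norml; apply/andP; split; nra.
Qed.

(** Every interval holds a point of [E], hence meets a ball of the cover, and a
    single ball meets at most [2 + 2 * (r / g)] of the intervals. *)
Lemma covering_number_pigeonhole (r len g : R) E s :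
  0 <= r -> 0 <= len -> 0 < g -> uniq s -> separated (len + g) s ->
  {in s, forall y, exists2 z, y <= z <= y + len & E z} ->
  (((size s)%:R / (2 + 2 * (r / g)))%:E <= covering_number E r)%E.
Proof.
move=> r0 len0 g0 us sep hit; apply: le_covering_number => n c cov.
have M0 : 0 < 2 + 2 * (r / g) by rewrite ltr_wpDr // mulr_ge0 // divr_ge0 // ltW.
rewrite ler_pdivrMr //.
pose meets i := [pred y | `[< exists2 z, y <= z <= y + len & ball (c i) r z >]].
apply: (@le_trans _ _ (\sum_(i < n) count (meets i) s)%:R).
  have : all (fun y => [exists i, meets i y]) s.
    apply/allP => y /hit[z yz /cov[i _ cz]].
    by apply/existsP; exists i; apply/asboolP; exists z.
  rewrite all_count => /eqP <-; rewrite ler_nat -sum1_count.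
  under [leqRHS]eq_bigr => i _ do rewrite -sum1_count big_mkcond.
  rewrite exchange_big /= big_mkcond /=; apply: leq_sum => y _.
  case: ifP => // /existsP[i mi].
  by rewrite (bigD1 i) //= [X in if X then _ else _]mi.
rewrite natr_sum [leRHS]mulr_natl -[X in _ *+ X](card_ord n) -sumr_const.
apply: ler_sum => i _; rewrite -size_filter.
apply: (@size_separated_meet_ball (c i) _ len); rewrite ?filter_uniq //.
- by move=> x y; rewrite !mem_filter => /andP[_ ?] /andP[_ ?]; exact: sep.
- by move=> y; rewrite mem_filter => /andP[/asboolP].
Qed.

End CoveringNumber.

(** * Packings of an interval *)

Section Packings.
Variable R : realType.
Implicit Types (a l len gap : R) (s : seq R).

Lemma packing_nth a l len gap s i : packing a l len gap s ->
  (i < size s)%N -> s`_i = s`_0 + i%:R * (len + gap).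
Proof.
move=> [/(sortedP 0) step _]; elim: i => [|i IHi] lt_is; first by rewrite mul0r addr0.
by move: (step i lt_is) => /eqP ->; rewrite IHi ?(ltnW lt_is)// -natr1; ring.
Qed.

Lemma packing_separated a l len gap s : 0 < len + gap ->
  packing a l len gap s -> separated (len + gap) s.
Proof.
move=> d0 ps x y /(nthP 0)[i iP <-] /(nthP 0)[j jP <-].
rewrite (packing_nth ps iP) (packing_nth ps jP) ltrD2l ltr_pM2r // ltr_nat => lt_ij.
by rewrite -addrA lerD2l -[X in _ + X]mul1r -mulrDl natr1 ler_pM2r // ler_nat.
Qed.

Lemma packing_uniq a l len gap s : 0 < len + gap ->
  packing a l len gap s -> uniq s.
Proof.
move=> d0 ps; apply/(uniqP 0) => i j; rewrite !inE => iP jP.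
rewrite (packing_nth ps iP) (packing_nth ps jP) => /addrI.
by move=> /(mulIf (lt0r_neq0 d0))/eqP; rewrite eqr_nat => /eqP.
Qed.

Lemma packing_bounds a l len gap s y : 0 <= len ->
  packing a l len gap s -> y \in s -> a <= y /\ y + len <= a + l.
Proof.
move=> len0 [_ inI] /inI sub.
have := sub y; have := sub (y + len).
by rewrite /= !in_itv /= !lexx lerDl len0 => /(_ isT)/andP[_ ?] /(_ isT)/andP[].
Qed.

Lemma packing_size_le a l len gap s : 0 <= len -> 0 < gap -> len <= l ->
  gap <= l -> packing a l len gap s -> (size s)%:R <= 2 * (l / gap).
Proof.
move=> len0 gap0 lenl gapl ps.
have d0 : 0 < len + gap by lra.
have := @size_separated _ (len + gap) a (l - len) s (ltW d0) _
  (packing_uniq d0 ps) (packing_separated d0 ps).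
move=> /(_ _ _) le; rewrite mulrA ler_pdivlMr //.
have : (size s)%:R * (len + gap) <= l - len + (len + gap).
  by apply: le => [|y /(packing_bounds len0 ps) []] *; [lra|apply/andP; split; lra].
have : 0 <= (size s)%:R * len by rewrite mulr_ge0.
lra.
Qed.

(** Optimality enters only here: a concrete progression of about
    [l / (4 * gap)] intervals fits, since two consecutive left endpoints are at
    most [2 * gap] apart. *)
Lemma optimal_packing_size_ge a l len gap s : 0 < len -> len <= gap ->
  len <= l -> optimal_packing a l len gap s ->
  (0 < size s)%N /\ l / gap / 4 <= (size s)%:R.
Proof.
move=> len0 lengap lenl [_ opt].
have q0 : 0 <= l / gap / 4 by rewrite !divr_ge0 //; lra.
have /andP[t1 t2] := truncn_itv q0.
set m := Num.truncn _ in t1 t2 *.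
pose s' := mkseq (fun i => a + i%:R * (len + gap)) m.+1.
suff : packing a l len gap s'.
  move=> /opt; rewrite size_mkseq => le_ms; split; first exact: leq_trans le_ms.
  by apply: (le_trans (ltW t2)); rewrite ler_nat.
have fits : m%:R * (len + gap) + len <= l.
  have [->|m0] := posnP m; first lra.
  have m1 : 1 <= m%:R :> R by rewrite ler1n.
  have gap0 : 0 < gap by lra.
  have : m%:R * gap * 4 <= l by move: t1; rewrite ler_pdivlMr // ler_pdivlMr //; lra.
  by nra.
split.
  apply/(sortedP 0) => i; rewrite size_mkseq => lt_im.
  by rewrite !nth_mkseq // 1?ltnW // -natr1; apply/eqP; ring.
move=> _ /mapP[i + ->] z; rewrite mem_iota /= add0n ltnS => le_im.
rewrite !in_itv /= => /andP[z1 z2].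
have : i%:R * (len + gap) <= m%:R * (len + gap) by rewrite ler_pM2r ?ler_nat //; lra.
have : 0 <= i%:R * (len + gap) by rewrite mulr_ge0 //; lra.
by move=> *; apply/andP; split; lra.
Qed.

(** A block of [n] consecutive intervals around [x], shifted inwards when [x] is
    too close to the right end of the packing. *)
Lemma packing_window a l len gap s x n : 0 <= len + gap ->
  packing a l len gap s -> x \in s -> (0 < n <= size s)%N ->
  exists s', [/\ {subset s' <= s}, uniq s -> uniq s', size s' = n &
    {in s', forall y, `|y - x| <= n.-1%:R * (len + gap)}].
Proof.
move=> d0 ps /(nthP 0)[i lt_is <-] /andP[n0 le_ns].
set N := size s in lt_is le_ns *.
pose j := minn i (N - n).
have j_i : (j <= i)%N := geq_minl _ _.
have j_n : (j + n <= N)%N by have : (j <= N - n)%N := geq_minr _ _; lia.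
have i_j : (i <= j + n.-1)%N.
  by rewrite /j minnE; lia.
clearbody j.
have sz : size (take n (drop j s)) = n.
  by rewrite size_takel // size_drop -/N; lia.
exists (take n (drop j s)); split => //.
- by move=> y /mem_take /mem_drop.
- by move=> us; rewrite take_uniq // drop_uniq.
move=> y /(nthP 0)[k]; rewrite sz => lt_kn <-.
have lt_jk : (j + k < N)%N by lia.
rewrite nth_take // nth_drop (packing_nth ps lt_jk) (packing_nth ps lt_is).
rewrite opprD addrACA subrr add0r.
rewrite -mulrBl normrM [X in _ * X]ger0_norm // ler_wpM2r // ler_norml.
have : (j + k <= i + n.-1)%N by lia.
have : (i <= j + k + n.-1)%N by lia.
by rewrite -!(ler_nat R) !natrD => *; apply/andP; split; lra.
Qed.

(** At scales between [len] and [l] the packing looks like a one-dimensional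
    net of mesh [gap] around each of its points, even near its two ends. *)
Lemma optimal_packing_near a l len gap s x rho : 0 < len -> len <= gap ->
  len < rho -> rho <= l -> optimal_packing a l len gap s -> x \in s ->
  exists s', [/\ {subset s' <= s}, uniq s', (0 < size s')%N,
    rho / gap / 4 <= (size s')%:R & {in s', forall y, `|y - x| + len < rho}].
Proof.
move=> len0 lengap lenr rl opt xs; have [ps _] := opt.
have [s0 sl] :=
  optimal_packing_size_ge len0 lengap (ltW (lt_le_trans lenr rl)) opt.
have q0 : 0 <= rho / gap / 4 by rewrite !divr_ge0 //; lra.
have /andP[t1 t2] := truncn_itv q0.
set m := Num.truncn _ in t1 t2.
have fits : m%:R * (len + gap) + len < rho.
  have [->|m0] := posnP m; first lra.
  have m1 : 1 <= m%:R :> R by rewrite ler1n.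
  have gap0 : 0 < gap by lra.
  have : m%:R * gap * 4 <= rho by move: t1; rewrite ler_pdivlMr // ler_pdivlMr //; lra.
  by nra.
have d0 : 0 < len + gap by lra.
have nP : (0 < minn m.+1 (size s) <= size s)%N by rewrite leq_min s0 geq_minr.
have [s' [sub us' sz near]] := packing_window (ltW d0) ps xs nP.
exists s'; split => //.
- exact: us' (packing_uniq d0 ps).
- by rewrite sz; case/andP: nP.
- rewrite sz /minn; case: ifP => _; first exact: ltW.
  by apply: le_trans sl; rewrite !ler_pM2r ?invr_gt0; lra.
- move=> y /near h; apply: le_lt_trans fits; rewrite lerD2r.
  apply: (le_trans h); rewrite ler_pM2r // ler_nat.
  by rewrite -ltnS (prednK (proj1 (andP nP))) geq_minl.
Qed.

End Packings.

(** * Functions with cusps at a geometric sequence *)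

Definition irregular (R : realType) (f : R -> R) : Prop :=
  [/\ ~ monotonic_on `]0, 1[%R f,
      exists J : nat -> interval R,
        [/\ forall n, [set` J n] `<=` `]0, 1[%classic,
            trivIset setT (fun n => [set` J n]) &
            forall n, ~ monotonic_on (J n) f] &
      infinite_set [set x | 0 < x < 1 /\ ~ derivable f x 1]].

Section Cusp.
Variables (R : realType) (f : R -> R) (p kappa c : R).
Hypotheses (p0 : 0 < p) (kappa1 : 1 < kappa) (c0 : 0 < c).

(** The difference quotients at [p] are at least [c] on the right and at most
    [- c] on the left. *)
Lemma cusp_not_derivable :
  (forall x, p / kappa <= x <= p * kappa -> f p + c * `|x - p| <= f x) ->
  ~ derivable f p 1.
Proof.
move=> cusp /cvg_ex[l /cvgrPdist_lt /(_ (c / 2) (divr_gt0 c0 (ltr0n _ 2)))].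
move=> /nbhs_ballP[e /= e0 H].
have kp : p < p * kappa by rewrite ltr_pMr.
have pk : p / kappa < p by rewrite ltr_pdivrMr // (lt_trans ltr01).
pose m := Num.min e (Num.min (p - p / kappa) (p * kappa - p)).
have m0 : 0 < m by rewrite !lt_min e0 /=; apply/andP; split; lra.
have me : m <= e by rewrite ge_min lexx.
have ml : m <= p - p / kappa by rewrite !ge_min lexx !orbT.
have mr : m <= p * kappa - p by rewrite !ge_min lexx !orbT.
pose h := m / 2.
have h0 : 0 < h by rewrite /h; lra.
have quot (y : R) : `|y| = h -> `|l - y^-1 * (f (y + p) - f p)| < c / 2.
  move=> yh; have := H y; rewrite -[y^-1 * _]/(y^-1 *: _) /= => /(_ _ _).
  rewrite -[y *: 1]/(y * 1) mulr1; apply.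
    by rewrite -ball_normE /= sub0r normrN yh /h; lra.
  by rewrite -normr_gt0 yh.
have h1 : `|h| = h by rewrite gtr0_norm.
have h2 : `|- h| = h by rewrite normrN.
have := quot h h1; have := quot (- h) h2.
rewrite !ltr_norml => /andP[a1 a2] /andP[b1 b2].
have := cusp (h + p); have := cusp (- h + p); rewrite !addrK h1 h2.
move=> /(_ _) c1 /(_ _) c2.
have {c1} : c <= - ((- h)^-1 * (f (- h + p) - f p)).
  rewrite invrN mulNr opprK mulrC ler_pdivlMr //.
  by have := c1 ltac:(apply/andP; split; rewrite /h; lra); lra.
have {c2} : c <= h^-1 * (f (h + p) - f p).
  rewrite mulrC ler_pdivlMr //.
  by have := c2 ltac:(apply/andP; split; rewrite /h; lra); lra.
lra.
Qed.

Lemma cusp_not_monotonic (J : interval R) :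
  (forall x, p / kappa <= x <= p * kappa -> f p + c * `|x - p| <= f x) ->
  [set` `]p / kappa, p * kappa[%R] `<=` [set` J] -> ~ monotonic_on J f.
Proof.
move=> cusp sub.
have kp : p < p * kappa by rewrite ltr_pMr.
have pk : p / kappa < p by rewrite ltr_pdivrMr // (lt_trans ltr01).
pose x := (p / kappa + p) / 2; pose y := (p + p * kappa) / 2.
have xJ : x \in J by apply: sub; rewrite /= in_itv /= /x; apply/andP; split; lra.
have pJ : p \in J by apply: sub; rewrite /= in_itv /= pk kp.
have yJ : y \in J by apply: sub; rewrite /= in_itv /= /y; apply/andP; split; lra.
have above z : p / kappa <= z <= p * kappa -> z != p -> f p < f z.
  move=> zI zp; apply: lt_le_trans (cusp z zI).
  by rewrite ltrDl mulr_gt0 // normr_gt0 subr_eq0.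
have fx : f p < f x.
  by apply: above; [apply/andP|apply/eqP]; rewrite /x; [split|]; lra.
have fy : f p < f y.
  by apply: above; [apply/andP|apply/eqP]; rewrite /y; [split|]; lra.
have xp : x <= p by rewrite /x; lra.
have py : p <= y by rewrite /y; lra.
by case=> mono; [have := mono x p xJ pJ xp|have := mono y p yJ pJ py]; lra.
Qed.

End Cusp.

Section GeometricCusps.
Variables (R : realType) (alpha kappa : R).
Hypotheses (kappa1 : 1 < kappa) (kappa_alpha : kappa ^+ 2 <= alpha).

Let theta n := (alpha ^+ n.+1)^-1.

Let k0 : 0 < kappa := lt_trans ltr01 kappa1.

Let a1 : 1 < alpha.
Proof. by apply: lt_le_trans kappa_alpha; rewrite exprn_egt1. Qed.

Let a0 : 0 < alpha := lt_trans ltr01 a1.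

Let theta_gt0 n : 0 < theta n.
Proof. by rewrite invr_gt0 exprn_gt0. Qed.

Let thetaS n : theta n = alpha * theta n.+1.
Proof. by rewrite /theta [in RHS]exprS invfM mulrA divff ?mul1r // gt_eqF. Qed.

Let theta_decr n : theta n.+1 <= theta n.
Proof. by rewrite [leRHS]thetaS ler_peMl // ltW. Qed.

Let theta_mono m n : (m < n)%N -> theta n * kappa <= theta m / kappa.
Proof.
move=> lt_mn; rewrite ler_pdivlMr // -mulrA -expr2.
elim: n lt_mn => // n IHn; rewrite ltnS leq_eqVlt => /orP[/eqP->|/IHn].
  by rewrite [leRHS]thetaS mulrC ler_pM2r ?theta_gt0.
by apply: le_trans; rewrite ler_pM2r ?exprn_gt0.
Qed.

(** A strict local minimum inside an interval rules out monotonicity there.  The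
    condition on [kappa] makes the neighbourhoods of the points
    [alpha ^- n.+1] pairwise disjoint. *)
Lemma geometric_cusps_irregular (c : R) (g : R -> R) :
  0 < c ->
  (forall n x, theta n / kappa <= x <= theta n * kappa ->
     g (theta n) + c * `|x - theta n| <= g x) ->
  irregular g.
Proof.
move=> c0 cusp.
have in01 n : [set` `]theta n / kappa, theta n * kappa[%R] `<=` `]0, 1[%classic.
  move=> x; rewrite /= !in_itv /= => /andP[x1 x2].
  rewrite (lt_trans _ x1) ?divr_gt0 //=; apply: (lt_le_trans x2).
  have : theta n <= theta 0%N.
    elim: n {x1 x2} => // n; exact: le_trans (theta_decr n).
  rewrite /theta expr1 => le; apply: (@le_trans _ _ (alpha^-1 * kappa)).
    by rewrite ler_pM2r.
  rewrite mulrC ler_pdivrMr // mul1r; apply: le_trans kappa_alpha.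
  by rewrite expr2 ler_peMl // ltW.
split.
- exact: cusp_not_monotonic (theta_gt0 0) kappa1 c0 _ (cusp 0%N) (in01 0%N).
- exists (fun n => `]theta n / kappa, theta n * kappa[%R); split => //.
    apply/trivIsetP => i j _ _ neq; rewrite -subset0 => x [] /=.
    rewrite !in_itv /= => /andP[x1 x2] /andP[x3 x4].
    by move: neq; rewrite neq_ltn => /orP[] /theta_mono; lra.
  by move=> n; exact: cusp_not_monotonic (theta_gt0 n) kappa1 c0 _ (cusp n) _.
- have inj : injective theta.
    move=> i j eq_ij; apply/eqP; apply: contraT; rewrite neq_ltn.
    have := theta_gt0 i; have := theta_gt0 j.
    move=> i0 j0 /orP[] /theta_mono; rewrite eq_ij ler_pdivlMr // -mulrA -expr2;
      by rewrite leNgt ltr_pMr // exprn_egt1.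
  have inf : infinite_set (range theta).
    move=> fin; apply: infinite_nat.
    have inj' : {in theta @^-1` range theta &, injective theta}.
      by move=> x y _ _; exact: inj.
    by apply: sub_finite_set (finite_preimage inj' fin) => n _; exists n.
  apply: sub_infinite_set inf.
  move=> _ [n _ <-]; split; last exact: cusp_not_derivable (theta_gt0 n) kappa1 c0 (cusp n).
  have := in01 n (theta n); rewrite /= !in_itv /=; apply.
  by rewrite ltr_pdivrMr // ltr_pMr // kappa1.
Qed.

End GeometricCusps.

(** * Covering numbers of the sets F *)

Section Powers.
Variables (R : realType) (L : R).
Hypotheses (L0 : 0 < L) (L1 : L < 1).

Let lnL : ln L < 0. Proof. by rewrite ln_lt0 // L0 L1. Qed.

Lemma powR_antitone (x y : R) : (L `^ y <= L `^ x) = (x <= y).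
Proof. by rewrite /powR gt_eqF // ler_expR ler_nM2r. Qed.

Lemma powR_antitone_lt (x y : R) : (L `^ y < L `^ x) = (x < y).
Proof. by rewrite !ltNge powR_antitone. Qed.

Lemma powR_base_lt1D (x y : R) : L `^ (x + y) = L `^ x * L `^ y.
Proof. by rewrite powRD // (gt_eqF L0) implybT. Qed.

Lemma powR_base_lt1B (x y : R) : L `^ (x - y) = L `^ x / L `^ y.
Proof. by rewrite powR_base_lt1D powRN. Qed.

End Powers.

(** Logarithm to base [1 / L], up to a constant, of the number of intervals of
    length [L `^ t] needed to cover the set, for [t] between [alpha ^+ k] and
    [alpha ^+ k.+1].  It grows with slope 1 until the gaps become visible, at
    [t = alpha ^+ k * beta], and stays constant until the intervals of the next
    step are resolved. *)
Definition log_count (R : realType) (alpha beta : R) (k : nat) (t : R) : R :=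
  (beta - 1) / (alpha - 1) * alpha ^+ k.+1 + Num.min (t - alpha ^+ k * beta) 0.

Section Construction.
Variables (R : realType) (alpha beta L a : R) (pack : nat -> R -> seq R).
Hypotheses (beta1 : 1 < beta) (alpha_beta : beta < alpha).
Hypotheses (L0 : 0 < L) (L1 : L < 1).

Let len k := L `^ (alpha ^+ k).
Let gap k := L `^ (alpha ^+ k * beta).
Let ep := endpoints a pack.

Hypothesis opt : forall k x, ep k x ->
  optimal_packing x (len k) (len k.+1) (gap k) (pack k x).

Let F := \bigcap_k step_set alpha L a pack k.+1.
Let b := (beta - 1) / (alpha - 1).

Let alphaX k : 0 < alpha ^+ k.
Proof. by rewrite exprn_gt0 // (lt_trans _ alpha_beta) // (lt_trans _ beta1). Qed.

Let len_gt0 k : 0 < len k. Proof. exact: powR_gt0. Qed.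
Let gap_gt0 k : 0 < gap k. Proof. exact: powR_gt0. Qed.

Let len_gap k : len k.+1 <= gap k.
Proof. by rewrite powR_antitone // exprSr ler_pM2l // ltW. Qed.

Let gap_len k : gap k <= len k.
Proof. by rewrite powR_antitone // ler_peMr // ltW. Qed.

Let len_decr k : len k.+1 <= len k.
Proof. exact: le_trans (len_gap k) (gap_len k). Qed.

Let len_over_gap k : len k / gap k = L `^ (- (b * (alpha ^+ k.+1 - alpha ^+ k))).
Proof.
rewrite -powR_base_lt1B //; congr (_ `^ _); rewrite /b exprS; field.
by rewrite gt_eqF // subr_gt0 (lt_trans beta1).
Qed.

Let child_packing k x : ep k x ->
  packing x (len k) (len k.+1) (gap k) (pack k x).
Proof. by move=> /opt[]. Qed.

Let child_bounds k x y : ep k x -> y \in pack k x ->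
  x <= y /\ y + len k.+1 <= x + len k.
Proof. by move=> /child_packing; exact: packing_bounds (ltW (len_gt0 _)). Qed.

Let step_gt0 k : 0 < len k.+1 + gap k. Proof. exact: addr_gt0. Qed.

Let ep_parent k y : ep k.+1 y -> exists2 x, ep k x & y \in pack k x.
Proof. by case=> x; exists x. Qed.

(** Children of different parents are even further apart than siblings, because
    the parents are separated by a larger gap. *)
Lemma endpoints_separated k x y : ep k.+1 x -> ep k.+1 y -> x < y ->
  x + (len k.+1 + gap k) <= y.
Proof.
elim: k x y => [|k IHk] x y /ep_parent[x0 x0E xx0] /ep_parent[y0 y0E yy0] lt_xy.
  move: (x0E) (y0E) xx0 yy0 => /= -> -> xa ya.
  by apply: packing_separated (step_gt0 0) (child_packing (erefl a : ep 0 a)) _ _ xa ya lt_xy.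
have [xl xr] := child_bounds x0E xx0; have [yl yr] := child_bounds y0E yy0.
have [lt0|gt0|eq0] := ltgtP x0 y0.
- have := IHk x0 y0 x0E y0E lt0; have := len_gap k; have := gap_len k.+1.
  by have := len_gt0 k.+1; lra.
- have := IHk y0 x0 y0E x0E gt0; have := gap_gt0 k; have := len_gt0 k.+2.
  by have := len_gt0 k.+1; lra.
- rewrite -eq0 in yy0.
  by apply: packing_separated (step_gt0 k.+1) (child_packing x0E) _ _ xx0 yy0 lt_xy.
Qed.

Let interval_inj k x y z : ep k x -> ep k y ->
  x <= z <= x + len k -> y <= z <= y + len k -> x = y.
Proof.
case: k => [-> -> //|k] xE yE /andP[x1 x2] /andP[y1 y2].
have := gap_gt0 k; have [lt_xy|lt_yx|//] := ltgtP x y.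
- by have := endpoints_separated xE yE lt_xy; lra.
- by have := endpoints_separated yE xE lt_yx; lra.
Qed.

Let step_setE k z : step_set alpha L a pack k z <->
  exists2 x, ep k x & x <= z <= x + len k.
Proof.
by split=> -[x xE xz]; exists x => //; move: xz; rewrite /= in_itv.
Qed.

Let step_set_child k x z : ep k x -> x <= z <= x + len k ->
  step_set alpha L a pack k.+1 z ->
  exists2 y, y \in pack k x & y <= z <= y + len k.+1.
Proof.
move=> xE xz /step_setE[y /ep_parent[x' x'E yx'] /andP[y1 y2]].
have [l1 l2] := child_bounds x'E yx'.
have -> : x = x' by apply: interval_inj xE x'E xz _; apply/andP; split; lra.
by exists y => //; apply/andP.
Qed.

Let step_set_nested i j : (i <= j)%N ->
  step_set alpha L a pack j `<=` step_set alpha L a pack i.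
Proof.
move=> /subnK <-; elim: (j - i)%N => [|d IHd] //= z; rewrite addSn.
move=> /step_setE[y /ep_parent[x xE yx] /andP[y1 y2]]; apply: IHd; apply/step_setE.
have [l1 l2] := child_bounds xE yx.
by exists x => //; apply/andP; split; lra.
Qed.

Let F_step z k : F z -> step_set alpha L a pack k z.
Proof. by move=> Fz; apply: (step_set_nested (leqnSn k)); exact: Fz. Qed.

Let children_ge k x : ep k x ->
  (0 < size (pack k x))%N /\ len k / gap k / 4 <= (size (pack k x))%:R.
Proof. by move=> /opt; apply: optimal_packing_size_ge. Qed.

(** Leftmost children form a nested sequence of intervals, whose left endpoints
    have a supremum lying in all of them. *)
Lemma attractor_meets_interval k x : ep k x ->
  exists2 z, x <= z <= x + len k & F z.
Proof.
move=> xE.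
pose c := fix c j := if j is j'.+1 then (pack (j' + k) (c j'))`_0 else x.
have cE j : ep (j + k) (c j) /\ c j.+1 \in pack (j + k) (c j).
  elim: j => [|j [IHj IHc]] /=; first by split=> //; rewrite mem_nth // (children_ge xE).1.
  have jE : ep (j.+1 + k) (c j.+1) by exists (c j).
  by split=> //; rewrite mem_nth // (children_ge jE).1.
have mono i j : c j <= c (i + j)%N /\
    c (i + j)%N + len ((i + j) + k) <= c j + len (j + k).
  elim: i => [|i [IH1 IH2]]; first by [].
  have [ijE ijc] := cE (i + j)%N.
  by have [] := child_bounds ijE ijc; split; rewrite ?addSn; lra.
have ub i j : c i <= c j + len (j + k).
  have [/subnK <-|/ltnW/subnK <-] := leqP j i.
    by have [_] := mono (i - j)%N j; have := len_gt0 ((i - j) + j + k); lra.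
  by have [+ _] := mono (j - i)%N i; have := len_gt0 ((j - i) + i + k); lra.
pose z := sup (range c).
have hs : has_sup (range c).
  by split; [exists x, 0%N|exists (x + len k) => _ [i _ <-]; exact: ub i 0%N].
have zj j : c j <= z <= c j + len (j + k).
  apply/andP; split; first by apply: sup_upper_bound => //; exists j.
  by apply: ge_sup => [|_ [i _ <-]]; [exists x, 0%N|].
exists z; first exact: (zj 0%N).
move=> i _; apply: (step_set_nested (leq_addr k i.+1)); apply/step_setE.
by exists (c i.+1); [exact: (cE i.+1).1|exact: zj].
Qed.

Fixpoint descendants (k j : nat) (s : seq R) : seq R :=
  if j is j'.+1 then flatten [seq pack (j' + k) y | y <- descendants k j' s]
  else s.

Lemma descendants_spec k j s : uniq s -> {in s, forall y, ep k y} ->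
  [/\ uniq (descendants k j s), {in descendants k j s, forall y, ep (j + k) y},
      (forall z, F z -> (exists2 y, y \in s & y <= z <= y + len k) ->
       exists2 y, y \in descendants k j s & y <= z <= y + len (j + k)) &
      {in descendants k j s, forall y,
        exists2 x, x \in s & x <= y /\ y + len (j + k) <= x + len k}].
Proof.
move=> us sE; elim: j => [|j [IHu IHe IHc IHp]] /=.
  by split=> // y ys; exists y.
have parent y : y \in flatten [seq pack (j + k) x | x <- descendants k j s] ->
    exists2 x, x \in descendants k j s & y \in pack (j + k) x.
  by move=> /flatten_mapP.
split.
- move: IHu IHe; elim: (descendants k j s) => [//|x t IHt] /= /andP[xt ut] tE.
  have tE' : {in t, forall y, ep (j + k) y}.
    by move=> y yt; apply: tE; rewrite in_cons yt orbT.
  have xE : ep (j + k) x by apply: tE; exact: mem_head.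
  rewrite cat_uniq IHt // andbT (packing_uniq (step_gt0 _) (child_packing xE)) /=.
  apply/hasPn => y /flatten_mapP[x' x't yx']; apply: contra xt => yx.
  have x'E := tE' _ x't.
  have [b1 b2] := child_bounds xE yx; have [b3 b4] := child_bounds x'E yx'.
  have := len_gt0 (j + k).+1 => l0.
  suff -> : x = x' by [].
  by apply: (@interval_inj (j + k) x x' y) => //; apply/andP; split; lra.
- by move=> y /parent[x xD yx]; exists x => //; exact: IHe.
- move=> z Fz /IHc -/(_ Fz)[x xD xz].
  have [y yx yz] := step_set_child (IHe x xD) xz (F_step _ Fz).
  by exists y => //; apply/flatten_mapP; exists x.
- move=> y /parent[x xD yx]; have [x0 x0s [h1 h2]] := IHp x xD.
  have [h3 h4] := child_bounds (IHe x xD) yx.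
  by exists x0 => //; split; rewrite ?addSn; lra.
Qed.

(** Between [1/4] and [2] times [len i / gap i] children are packed at each step,
    and the product of these ratios telescopes.  The constants depend on the
    number [j] of steps alone, which stays bounded when the two scales are
    [r] and [r `^ theta^-1]. *)
Lemma size_descendants k j s : uniq s -> {in s, forall y, ep k y} ->
  let w := L `^ (- (b * (alpha ^+ (j + k) - alpha ^+ k))) in
  (size s)%:R / 4 ^+ j * w <= (size (descendants k j s))%:R <=
  (size s)%:R * 2 ^+ j * w.
Proof.
move=> us sE /=; elim: j => [|j /andP[IH1 IH2]].
  by rewrite !expr0 !(mulr1, divr1) subrr mulr0 oppr0 powRr0 !mulr1 lexx.
have [_ dE _ _] := descendants_spec j us sE.
have -> : L `^ (- (b * (alpha ^+ (j.+1 + k) - alpha ^+ k))) =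
    L `^ (- (b * (alpha ^+ (j + k) - alpha ^+ k))) * (len (j + k) / gap (j + k)).
  by rewrite len_over_gap -powR_base_lt1D // addSn; congr (_ `^ _); ring.
move: IH1 IH2 dE => /=; set w := _ `^ _; set q := _ / gap _.
have q0 : 0 < q by rewrite divr_gt0.
set D := descendants k j s => IH1 IH2 dE.
have step : (size D)%:R * (q / 4) <=
    (size (flatten [seq pack (j + k) y | y <- D]))%:R <= (size D)%:R * (2 * q).
  elim: D dE {IH1 IH2} => [|x t IHt] dE /=; first by rewrite !mul0r lexx.
  have /IHt /andP[h1 h2] : {in t, forall y, ep (j + k) y}.
    by move=> y yt; apply: dE; rewrite in_cons yt orbT.
  have xE : ep (j + k) x by apply: dE; exact: mem_head.
  have [_ h3] := children_ge xE.
  have h4 := packing_size_le (ltW (len_gt0 _)) (gap_gt0 _) (len_decr _)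
    (gap_len _) (child_packing xE).
  have sizeS c : (size t).+1%:R * c = c + (size t)%:R * c :> R.
    by rewrite -natr1 mulrDl mul1r addrC.
  by rewrite size_cat natrD !sizeS; apply/andP; split; apply: lerD.
have /andP[h1 h2] := step; apply/andP; split.
  apply: le_trans h1; rewrite exprS invfM.
  have -> : (size s)%:R * (4^-1 / 4 ^+ j) * (w * q) =
    (size s)%:R / 4 ^+ j * w * (q / 4) by ring.
  by rewrite ler_pM2r // divr_gt0.
apply: (le_trans h2); rewrite exprS.
have -> : (size s)%:R * (2 * 2 ^+ j) * (w * q) =
    (size s)%:R * 2 ^+ j * w * (2 * q) by ring.
by rewrite ler_pM2r // mulr_gt0.
Qed.


(** The intervals of step [k.+1] that meet the ball are counted by separation,
    each is replaced by its descendants after [j] more steps, and each descendant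
    is covered by [p] balls. *)
Lemma covering_number_le_descendants j k p (x rho r : R) :
  0 < rho -> 0 < r -> (0 < p)%N -> len (j + k.+1) <= p%:R * r ->
  (covering_number (ball x rho `&` F) r <=
   ((2 + 2 * (rho / gap k)) * 2 ^+ j *
    L `^ (- (b * (alpha ^+ (j + k.+1) - alpha ^+ k.+1))) * p%:R)%:E)%E.
Proof.
move=> rho0 r0 p0 len_p.
have [u0 e0 c0 _] := @descendants_spec 0 k.+1 [:: a] isT
  (fun y => ltac:(by rewrite inE => /eqP ->)).
rewrite addn0 in e0 c0.
pose meets := [pred y | `[< exists2 z, y <= z <= y + len k.+1 & ball x rho z >]].
set s0 := descendants 0 k.+1 [:: a] in u0 e0 c0.
pose s := [seq y <- s0 | meets y].
have us : uniq s by rewrite filter_uniq.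
have sE : {in s, forall y, ep k.+1 y} by move=> y; rewrite mem_filter => /andP[_ /e0].
have size_s : (size s)%:R <= 2 + 2 * (rho / gap k).
  apply: (@size_separated_meet_ball _ x _ (len k.+1) _ _ (ltW rho0)
    (ltW (len_gt0 _)) (gap_gt0 k) us).
    by move=> y z /sE yE /sE zE; exact: endpoints_separated.
  by move=> y; rewrite mem_filter => /andP[/asboolP].
have [uD eD cD _] := descendants_spec j us sE.
apply: (le_trans (covering_number_tiled p0 r0 len_p _ (s := descendants k.+1 j s))).
  move=> z [xz Fz]; apply: (cD z Fz).
  have [|y ys0 yz] := c0 z Fz.
    exists a; first exact: mem_head.
    by have /step_setE[_ -> ] := F_step 0 Fz.
  by exists y => //; rewrite mem_filter ys0 andbT; apply/asboolP; exists z.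
rewrite lee_fin ler_pM2r ?ltr0n //.
have /andP[_ ub] := size_descendants j us sE; apply: (le_trans ub).
by rewrite ler_pM2r ?powR_gt0 // ler_pM2r // exprn_gt0.
Qed.

(** The point [x] lies in an interval of step [k.+1], around which enough
    siblings fit inside the ball; all their descendants after [j] more steps
    contain points of the set, and the pigeonhole bound applies to them. *)
Lemma covering_number_ge_descendants j k (x rho r : R) :
  F x -> len k.+1 < rho -> rho <= len k -> 0 < r ->
  ((Num.max 1 (rho / gap k / 4) / 4 ^+ j *
    L `^ (- (b * (alpha ^+ (j + k.+1) - alpha ^+ k.+1))) /
    (2 + 2 * (r / gap (j + k))))%:E <= covering_number (ball x rho `&` F) r)%E.
Proof.
move=> Fx len_rho rho_len r0.
have /step_setE[x0 x0E x0x] := F_step k Fx.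
have [y0 y0x0 /andP[y0x xy0]] := step_set_child x0E x0x (F_step k.+1 Fx).
have [s [sub us s0 sge near]] :=
  optimal_packing_near (len_gt0 _) (len_gap k) len_rho rho_len (opt x0E) y0x0.
have sE : {in s, forall y, ep k.+1 y} by move=> y /sub yx; exists x0.
have [uD eD _ pD] := descendants_spec j us sE.
have := @covering_number_pigeonhole _ r (len (j + k.+1)) (gap (j + k))
  (ball x rho `&` F) _ (ltW r0) (ltW (len_gt0 _)) (gap_gt0 _) uD.
move=> /(_ _ _) le; apply: le_trans (le _ _).
- rewrite lee_fin ler_pM2r; last first.
    by rewrite invr_gt0 ltr_wpDr // mulr_ge0 // divr_ge0 // ltW.
  have /andP[lb _] := size_descendants j us sE; apply: le_trans lb.
  rewrite ler_pM2r ?powR_gt0 // ler_pM2r ?invr_gt0 ?exprn_gt0 //.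
  by rewrite ge_max sge ler1n s0.
- move=> y z /eD yE /eD zE; rewrite addnS in yE zE *.
  exact: endpoints_separated.
- move=> y yD; have [z yz Fz] := attractor_meets_interval (eD y yD).
  exists z => //; split=> //.
  have [y1 y1s [h1 h2]] := pD y yD; have := near y1 y1s.
  move: yz => /andP[h3 h4]; rewrite -ball_normE /= => h5.
  have : `|y1 - y0| < rho - len k.+1 by lra.
  by rewrite !ltr_norml => /andP[h6 h7]; apply/andP; split; lra.
Qed.

Let one_plus_ratio k t : 2 + 2 * (L `^ t / gap k) <=
  4 * L `^ Num.min (t - alpha ^+ k * beta) 0.
Proof.
have h1 : 1 <= L `^ Num.min (t - alpha ^+ k * beta) 0.
  by rewrite -[leLHS](powRr0 L) powR_antitone // ge_min lexx orbT.
have h2 : L `^ t / gap k <= L `^ Num.min (t - alpha ^+ k * beta) 0.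
  by rewrite -powR_base_lt1B // powR_antitone // ge_min lexx.
lra.
Qed.

Let max_ratio k t : L `^ Num.min (t - alpha ^+ k * beta) 0 / 4 <=
  Num.max 1 (L `^ t / gap k / 4).
Proof.
rewrite le_max -powR_base_lt1B //; have [_|_] := leP (t - alpha ^+ k * beta) 0.
  by rewrite lexx orbT.
by rewrite powRr0; apply/orP; left; lra.
Qed.

Let h := log_count alpha beta.

Let b_step k : b * alpha ^+ k.+1 - b * alpha ^+ k = (beta - 1) * alpha ^+ k.
Proof.
rewrite /b exprS; field.
by rewrite gt_eqF // subr_gt0 (lt_trans beta1).
Qed.

(** At a radius above the gap scale of its block the cover uses
    pieces of the intervals of that step, below it one ball for each interval of
    the next step. *)
Lemma covering_number_le_profile n : exists2 C : R, 0 < C &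
  forall k t u x, alpha ^+ (n.+1 + k) <= u <= alpha ^+ (n.+1 + k).+1 ->
  (covering_number (ball x (L `^ t) `&` F) (L `^ u) <=
   (C * L `^ (h k t - h (n.+1 + k) u))%:E)%E.
Proof.
exists (4 * 2 ^+ n * 2); first by rewrite !mulr_gt0 // exprn_gt0.
move=> k t u x /andP[u1 u2].
have t0 : 0 < L `^ t by exact: powR_gt0.
have u0 : 0 < L `^ u by exact: powR_gt0.
have w0 (v : R) : 0 < L `^ v by exact: powR_gt0.
have [u_beta|beta_u] := leP u (alpha ^+ (n.+1 + k) * beta).
  have E : (n + k.+1 = n.+1 + k)%N by rewrite addSnnS.
  have q1 : 1 <= len (n.+1 + k) / L `^ u.
    by rewrite -powR_base_lt1B // -[leLHS](powRr0 L) powR_antitone // subr_le0.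
  have /andP[p1 p2] := truncn_itv (le_trans ler01 q1).
  have := @covering_number_le_descendants n k (Num.truncn (len (n.+1 + k) / L `^ u)).+1
     x (L `^ t) (L `^ u) t0 u0 isT.
  rewrite E => /(_ _)/le_trans; apply.
    by rewrite -ler_pdivrMr // ltW.
  rewrite lee_fin.
  apply: (@le_trans _ _ (4 * L `^ Num.min (t - alpha ^+ k * beta) 0 * 2 ^+ n *
     L `^ (- (b * (alpha ^+ (n.+1 + k) - alpha ^+ k.+1))) *
     (2 * (len (n.+1 + k) / L `^ u)))).
    apply: ler_pM.
    - rewrite !mulr_ge0 ?powR_ge0 ?exprn_ge0 // addr_ge0 // mulr_ge0 //.
      by rewrite divr_ge0 ?powR_ge0.
    - by [].
    - by rewrite ler_pM2r // ler_pM2r ?exprn_gt0.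
    - by rewrite -natr1; lra.
  rewrite -powR_base_lt1B // [leLHS](_ : _ = 4 * 2 ^+ n * 2 *
    (L `^ Num.min (t - alpha ^+ k * beta) 0 *
     L `^ (- (b * (alpha ^+ (n.+1 + k) - alpha ^+ k.+1))) *
     L `^ (alpha ^+ (n.+1 + k) - u))); last by ring.
  rewrite -!powR_base_lt1D // ler_pM2l ?mulr_gt0 ?exprn_gt0 // powR_antitone //.
  rewrite /h /log_count -/b (min_l (x := u - _)) ?subr_le0 //.
  by have := b_step (n.+1 + k); lra.
have := @covering_number_le_descendants n.+1 k 1 x (L `^ t) (L `^ u) t0 u0 isT.
rewrite addnS mul1r => /(_ _)/le_trans; apply; first by rewrite powR_antitone.
rewrite lee_fin mulr1.
apply: (@le_trans _ _ (4 * L `^ Num.min (t - alpha ^+ k * beta) 0 * 2 ^+ n.+1 *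
     L `^ (- (b * (alpha ^+ (n.+1 + k).+1 - alpha ^+ k.+1))))).
  by rewrite ler_pM2r // ler_pM2r ?exprn_gt0.
rewrite [leLHS](_ : _ = 4 * 2 ^+ n * 2 *
    (L `^ Num.min (t - alpha ^+ k * beta) 0 *
     L `^ (- (b * (alpha ^+ (n.+1 + k).+1 - alpha ^+ k.+1))))); last by rewrite exprS; ring.
rewrite -!powR_base_lt1D // ler_pM2l ?mulr_gt0 ?exprn_gt0 // powR_antitone //.
rewrite /h /log_count -/b (@min_r _ _ (u - _)); first lra.
by rewrite subr_ge0 ltW.
Qed.

(** Matching bound: a ball of radius [L `^ u] wider than the gaps absorbs
    [L `^ u / gap] descendants, which is the second minimum in
    [log_count]. *)
Lemma covering_number_ge_profile n : exists2 c : R, 0 < c &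
  forall k t u x, F x -> alpha ^+ k <= t < alpha ^+ k.+1 ->
  ((c * L `^ (h k t - h (n + k) u))%:E <=
   covering_number (ball x (L `^ t) `&` F) (L `^ u))%E.
Proof.
exists (4 * 4 ^+ n * 4)^-1; first by rewrite invr_gt0 !mulr_gt0 // exprn_gt0.
move=> k t u x Fx /andP[t1 t2].
have u0 : 0 < L `^ u by exact: powR_gt0.
have w0 (v : R) : 0 < L `^ v by exact: powR_gt0.
have := @covering_number_ge_descendants n k x (L `^ t) (L `^ u) Fx.
rewrite powR_antitone // powR_antitone_lt // => /(_ t2 t1 u0); apply: le_trans.
rewrite lee_fin addnS.
have M0 : 0 < 2 + 2 * (L `^ u / gap (n + k)).
  by rewrite ltr_wpDr // mulr_ge0 // divr_ge0 // ltW.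
apply: (@le_trans _ _ (L `^ Num.min (t - alpha ^+ k * beta) 0 / 4 / 4 ^+ n *
    L `^ (- (b * (alpha ^+ (n + k).+1 - alpha ^+ k.+1))) /
    (4 * L `^ Num.min (u - alpha ^+ (n + k) * beta) 0))).
  have -> : h k t - h (n + k) u = Num.min (t - alpha ^+ k * beta) 0 -
      (b * (alpha ^+ (n + k).+1 - alpha ^+ k.+1)) -
      Num.min (u - alpha ^+ (n + k) * beta) 0.
    by rewrite /h /log_count -/b; ring.
  rewrite powR_base_lt1B // powR_base_lt1D // !invfM.
  by rewrite le_eqVlt; apply/orP; left; apply/eqP; ring.
apply: ler_pM.
- by rewrite !mulr_ge0 ?invr_ge0 ?exprn_ge0 ?powR_ge0.
- by rewrite invr_ge0 mulr_ge0 // powR_ge0.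
- by rewrite ler_pM2r // ler_pM2r ?invr_gt0 ?exprn_gt0.
- by rewrite lef_pV2 ?posrE ?mulr_gt0.
Qed.

End Construction.

(** * Admissible exponents at geometric scales *)

Section Exponents.
Variable R : realType.
Implicit Types (F : set R) (alpha L theta s t : R).

Lemma expr_unbounded alpha (K : nat) (M : R) : 1 < alpha ->
  exists2 k, (K <= k)%N & M < alpha ^+ k.
Proof.
move=> alpha1.
have bernoulli k : k%:R * (alpha - 1) <= alpha ^+ k.
  elim: k => [|k IHk]; first by rewrite mul0r expr0.
  have : 1 <= alpha ^+ k by rewrite exprn_ege1 // ltW.
  by rewrite exprS -natr1; nra.
exists (K + Num.bound `|M / (alpha - 1)|)%N; first exact: leq_addr.
apply: lt_le_trans (bernoulli _); rewrite -ltr_pdivrMr ?subr_gt0 //.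
apply: (le_lt_trans (ler_norm _)); apply: (lt_le_trans (archi_boundP (normr_ge0 _))).
by rewrite ler_nat leq_addl.
Qed.

Lemma geometric_block alpha t : 1 < alpha -> 1 <= t ->
  exists k, alpha ^+ k <= t < alpha ^+ k.+1.
Proof.
move=> alpha1 t1; have ex : exists k, t < alpha ^+ k.
  by have [k _ tk] := expr_unbounded 0 t alpha1; exists k.
case: (ex_minnP ex) => -[|k] tk kmin; first by move: tk; rewrite expr0; lra.
exists k; rewrite tk andbT leNgt; apply/negP => /kmin.
by rewrite ltnn.
Qed.

(** Multiplicative constants do not matter along a sequence of scales whose
    logarithms tend to infinity. *)
Lemma compare_exponents alpha L (c C p q : R) (K : nat) :
  1 < alpha -> 0 < L -> L < 1 -> 0 < c -> 0 < C ->
  (forall k, (K <= k)%N -> c * L `^ (p * alpha ^+ k) <= C * L `^ (q * alpha ^+ k)) ->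
  q <= p.
Proof.
move=> alpha1 L0 L1 c0 C0 cmp; rewrite leNgt; apply/negP => pq.
have lnL : ln L < 0 by rewrite ln_lt0 // L0 L1.
have [k Kk] := expr_unbounded K (ln (C / c) / ((p - q) * ln L)) alpha1.
have D0 : 0 < (p - q) * ln L by nra.
rewrite ltr_pdivrMr // => big.
have : L `^ ((p - q) * alpha ^+ k) <= C / c.
  rewrite mulrBl powR_base_lt1B // ler_pdivrMr ?powR_gt0 //.
  rewrite mulrAC ler_pdivlMr // mulrC; exact: cmp.
rewrite -ler_ln ?posrE ?powR_gt0 ?divr_gt0 // ln_powR.
by move: big; rewrite -mulrA (mulrC (alpha ^+ k)) -mulrA (mulrC (ln L)) mulrA; lra.
Qed.

Definition assouad_exponents F theta : set R :=
  [set s : R | exists C : R, exists rho : R, [/\ 0 < C, 0 < rho &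
    forall (r : R) (x : R), 0 < r <= rho -> F x ->
      (covering_number (ball x r `&` F) (r `^ theta^-1)
        <= (C * (r / r `^ theta^-1) `^ s)%:E)%E]].

Definition lower_exponents F theta : set R :=
  [set s : R | exists C : R, exists rho : R, [/\ 0 < C, 0 < rho &
    forall (r : R) (x : R), 0 < r <= rho -> F x ->
      (covering_number (ball x r `&` F) (r `^ theta^-1)
        >= (C * (r / r `^ theta^-1) `^ s)%:E)%E]].

Lemma log_scale L theta s t : 0 < L -> L < 1 ->
  (L `^ t / (L `^ t) `^ theta^-1) `^ s = L `^ ((t - t / theta) * s).
Proof. by move=> L0 L1; rewrite -powRrM -powR_base_lt1B // -powRrM. Qed.

Lemma exists_log L (r : R) : 0 < L -> L < 1 -> 0 < r <= L ->
  exists2 t, 1 <= t & r = L `^ t.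
Proof.
move=> L0 L1 /andP[r0 rL]; have lnL : ln L < 0 by rewrite ln_lt0 // L0 L1.
have E : r = L `^ (ln r / ln L).
  by rewrite /powR gt_eqF // divfK ?lt_eqF // lnK ?posrE.
exists (ln r / ln L) => //.
by rewrite -(powR_antitone L0 L1) -E powRr1 // ltW.
Qed.

(** Writing the radius as [L `^ t] turns the defining inequality into one between
    exponents; radii at most [L] correspond to [1 <= t]. *)
Lemma assouad_exponents_intro F L theta s (C : R) :
  0 < L -> L < 1 -> 0 < C ->
  (forall t x, 1 <= t -> F x ->
    (covering_number (ball x (L `^ t) `&` F) (L `^ (t / theta)) <=
     (C * L `^ ((t - t / theta) * s))%:E)%E) ->
  assouad_exponents F theta s.
Proof.
move=> L0 L1 C0 H; exists C, L; split=> // r x rL Fx.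
by have [t t1 ->] := exists_log L0 L1 rL; rewrite log_scale // -powRrM; exact: H.
Qed.

Lemma lower_exponents_intro F L theta s (C : R) :
  0 < L -> L < 1 -> 0 < C ->
  (forall t x, 1 <= t -> F x ->
    ((C * L `^ ((t - t / theta) * s))%:E <=
     covering_number (ball x (L `^ t) `&` F) (L `^ (t / theta)))%E) ->
  lower_exponents F theta s.
Proof.
move=> L0 L1 C0 H; exists C, L; split=> // r x rL Fx.
by have [t t1 ->] := exists_log L0 L1 rL; rewrite log_scale // -powRrM; exact: H.
Qed.

Lemma eventually_small alpha L (tau rho : R) :
  1 < alpha -> 0 < L -> L < 1 -> 0 < tau -> 0 < rho ->
  exists K, forall k, (K <= k)%N -> L `^ (tau * alpha ^+ k) <= rho.
Proof.
move=> alpha1 L0 L1 tau0 rho0.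
have lnL : ln L < 0 by rewrite ln_lt0 // L0 L1.
have [K _ big] := expr_unbounded 0 (ln rho / ln L / tau) alpha1.
exists K => k Kk.
have : ln rho / ln L <= tau * alpha ^+ k.
  rewrite [leRHS]mulrC -ler_pdivrMr //; apply: le_trans (ltW big) _.
  by rewrite ler_eXn2l.
rewrite -(powR_antitone L0 L1) => /le_trans; apply.
by rewrite {1}/powR gt_eqF // divfK ?lt_eqF // lnK ?posrE.
Qed.

(** To bound all admissible exponents it suffices to test one point at the
    geometric sequence of scales [tau * alpha ^+ k]. *)
Lemma assouad_exponents_ge F alpha L theta s (x c tau p : R) :
  1 < alpha -> 0 < L -> L < 1 -> F x -> 0 < c -> 0 < tau ->
  (forall k, ((c * L `^ (p * alpha ^+ k))%:E <=
     covering_number (ball x (L `^ (tau * alpha ^+ k)) `&` F)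
       (L `^ (tau / theta * alpha ^+ k)))%E) ->
  assouad_exponents F theta s -> (tau - tau / theta) * s <= p.
Proof.
move=> alpha1 L0 L1 Fx c0 tau0 lb [C [rho [C0 rho0 ub]]].
have [K small] := eventually_small alpha1 L0 L1 tau0 rho0.
apply: (@compare_exponents alpha L c C _ _ K) => // k /small rk.
have := ub (L `^ (tau * alpha ^+ k)) x; rewrite powR_gt0 // rk => /(_ isT Fx).
rewrite log_scale // -powRrM mulrAC => /(le_trans (lb k)); rewrite lee_fin.
by congr (_ <= _ * _ `^ _); ring.
Qed.

Lemma lower_exponents_le F alpha L theta s (x c tau p : R) :
  1 < alpha -> 0 < L -> L < 1 -> F x -> 0 < c -> 0 < tau ->
  (forall k, (covering_number (ball x (L `^ (tau * alpha ^+ k)) `&` F)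
       (L `^ (tau / theta * alpha ^+ k)) <= (c * L `^ (p * alpha ^+ k))%:E)%E) ->
  lower_exponents F theta s -> p <= (tau - tau / theta) * s.
Proof.
move=> alpha1 L0 L1 Fx c0 tau0 ub [C [rho [C0 rho0 lb]]].
have [K small] := eventually_small alpha1 L0 L1 tau0 rho0.
apply: (@compare_exponents alpha L C c _ _ K) => // k /small rk.
have := lb (L `^ (tau * alpha ^+ k)) x; rewrite powR_gt0 // rk => /(_ isT Fx).
rewrite log_scale // -powRrM mulrAC => /le_trans/(_ (ub k)); rewrite lee_fin.
by congr (_ * _ `^ _ <= _); ring.
Qed.

(** A ball of radius [r] on the line is covered by a multiple of [r / r'] balls of
    radius [r']; so the infimum defining the Assouad spectrum is over a nonempty
    set. *)
Lemma assouad_exponents1 F L theta : 0 < L -> L < 1 -> 0 < theta -> theta < 1 ->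
  assouad_exponents F theta 1.
Proof.
move=> L0 L1 theta0 theta1.
apply: (@assouad_exponents_intro _ L _ _ 3) => // t x t1 Fx.
have q1 : 1 <= L `^ t / L `^ (t / theta).
  rewrite -powR_base_lt1B // -[leLHS](powRr0 L) powR_antitone // subr_le0.
  by rewrite ler_pdivlMr // ler_piMr //; lra.
have q0 : 0 <= 2 * (L `^ t / L `^ (t / theta)) by lra.
have r0 : 0 < L `^ (t / theta) by exact: powR_gt0.
have /andP[p1 p2] := truncn_itv q0.
apply: (le_trans (@covering_number_tiled _
  (Num.truncn (2 * (L `^ t / L `^ (t / theta)))).+1 _ (2 * L `^ t) _
  [:: x - L `^ t] _ r0 _ _)) => //.
- by rewrite -ler_pdivrMr // -mulrA ltW.
- move=> z [+ _]; rewrite -ball_normE /= ltr_norml => /andP[z1 z2].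
  by exists (x - L `^ t); [exact: mem_head|apply/andP; split; lra].
- by rewrite lee_fin mul1r mulr1 powR_base_lt1B // -natr1; lra.
Qed.

(** A ball about a point of the set needs at least one covering ball; so the
    supremum defining the lower spectrum is over a nonempty set. *)
Lemma lower_exponents0 F L theta : 0 < L -> L < 1 -> lower_exponents F theta 0.
Proof.
move=> L0 L1; apply: (@lower_exponents_intro _ L _ _ 1) => // t x t1 Fx.
rewrite mulr0 powRr0 mulr1; apply: le_covering_number => n c cov.
have [|i _ _] := cov x; last by rewrite ler1n (leq_trans _ (ltn_ord i)).
by split=> //; apply: ballxx; exact: powR_gt0.
Qed.

End Exponents.

Section Profile.
Variables (R : realType) (alpha beta : R).
Hypotheses (beta1 : 1 < beta) (alpha_beta : beta < alpha).

Let b := (beta - 1) / (alpha - 1).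
Let B := b * alpha / beta.
Let h := log_count alpha beta.

(** Here [b] and [B] are the lower and upper limits of [h k t / t], that is, the
    lower and upper box dimensions of the set. *)
Lemma lower_box_dim_bounds : [/\ 0 < b, b < 1 & b * (alpha - 1) = beta - 1].
Proof.
have h1 := beta1; have h2 := alpha_beta; have a1 : 0 < alpha - 1 by lra.
have b1 : 0 < beta - 1 by lra.
by rewrite /b divfK ?gt_eqF // ltr_pdivrMr // (divr_gt0 b1 a1); split=> //; lra.
Qed.

Lemma upper_box_dim_bounds : [/\ 0 < B, B < 1 & B * beta = b * alpha].
Proof.
have h1 := beta1; have h2 := alpha_beta; have [b0 b1 bE] := lower_box_dim_bounds.
have beta0 : 0 < beta by lra.
have a0 : 0 < alpha by lra.
have ba0 : 0 < b * alpha by exact: mulr_gt0.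
by rewrite /B divfK ?gt_eqF // ltr_pdivrMr // (divr_gt0 ba0 beta0); split=> //; lra.
Qed.

Lemma log_count_scale n k t :
  h (n + k) (alpha ^+ n * t) = alpha ^+ n * h k t.
Proof.
have a0 : 0 < alpha by apply: lt_trans alpha_beta; exact: lt_trans beta1.
rewrite /h /log_count -addnS !exprD mulrDr minr_pMr ?exprn_ge0 ?ltW //.
by rewrite mulr0; congr (_ + Num.min _ _); ring.
Qed.

(** On a block [h k t / t] equals [b] at both ends, increases up to
    [t = alpha ^+ k * beta], where it equals [B], and decreases afterwards. *)
Lemma log_count_bounds k t : alpha ^+ k <= t <= alpha ^+ k.+1 ->
  b * t <= h k t <= B * t.
Proof.
have h1 := beta1; have h2 := alpha_beta.
have [b0 b1 bE] := lower_box_dim_bounds; have [B0 B1 BE] := upper_box_dim_bounds.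
have : 0 < alpha ^+ k by rewrite exprn_gt0 //; lra.
rewrite /h /log_count -/b exprS; set A := alpha ^+ k => A0 /andP[t1 t2].
by have [le|lt] := leP (t - A * beta) 0; apply/andP; split; nra.
Qed.

End Profile.

(** * Cusps of the two spectra *)

Section Spectra.
Variables (R : realType) (alpha beta L a : R) (pack : nat -> R -> seq R).
Hypotheses (beta1 : 1 < beta) (alpha_beta : beta < alpha).
Hypotheses (L0 : 0 < L) (L1 : L < 1).
Hypothesis opt : forall k x, endpoints a pack k x ->
  optimal_packing x (L `^ (alpha ^+ k)) (L `^ (alpha ^+ k.+1))
    (L `^ (alpha ^+ k * beta)) (pack k x).

Let F := \bigcap_k step_set alpha L a pack k.+1.
Let b := (beta - 1) / (alpha - 1).
Let B := b * alpha / beta.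
Let h := log_count alpha beta.
Let theta n := (alpha ^+ n.+1)^-1.
Let kappa := (1 + Num.min beta (alpha / beta)) / 2.

Let alpha1 : 1 < alpha. Proof. exact: lt_trans alpha_beta. Qed.
Let alpha0 : 0 < alpha. Proof. exact: lt_trans alpha1. Qed.
Let beta0 : 0 < beta. Proof. exact: lt_trans beta1. Qed.
Let alphaX n : 0 < alpha ^+ n. Proof. exact: exprn_gt0. Qed.
Let alphaX1 n : alpha <= alpha ^+ n.+1.
Proof. by rewrite exprS ler_peMr ?exprn_ege1 ?ltW. Qed.

(** The number [kappa] is chosen so that moving a scale by the factor [kappa] from
    [alpha ^+ k] or from [alpha ^+ k * beta] does not cross the neighbouring break
    points of [log_count]. *)
Lemma kappa_bounds : [/\ 1 < kappa, kappa < beta & kappa * beta < alpha].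
Proof.
have h1 := beta1; have h2 := beta0.
have h3 : 1 < alpha / beta by rewrite ltr_pdivlMr // mul1r.
rewrite -(ltr_pdivlMr _ _ beta0) /kappa.
by split; rewrite /Num.min; case: ifP => //; lra.
Qed.

Let kappa_sqr : kappa ^+ 2 <= alpha.
Proof.
have [k1 kb kba] := kappa_bounds; apply: le_trans (ltW kba).
by rewrite expr2 ler_pM2l ?ltW // (lt_trans ltr01).
Qed.

Let theta_gt0 n : 0 < theta n. Proof. by rewrite invr_gt0. Qed.

Let theta_lt1 n x : x <= theta n * kappa -> x < 1.
Proof.
move=> /le_lt_trans; apply; have [k1 kb _] := kappa_bounds.
rewrite mulrC ltr_pdivrMr // mul1r; apply: lt_le_trans (alphaX1 n).
exact: lt_trans alpha_beta.
Qed.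

Let point : exists x, F x.
Proof.
have [z _ Fz] := attractor_meets_interval beta1 alpha_beta L0 L1 opt
  (erefl a : endpoints a pack 0 a).
by exists z.
Qed.

(** For [theta n] the two scales are [t] and [alpha ^+ n.+1 * t], so by
    self-similarity the covering exponent is [(alpha ^+ n.+1 - 1) * h k t], which
    is at most [B] times the logarithmic distance of the scales. *)
Lemma upper_box_dim_assouad_exponent n : assouad_exponents F (theta n) B.
Proof.
have [C C0 ub] := covering_number_le_profile beta1 alpha_beta L0 L1 opt n.
apply: (assouad_exponents_intro L0 L1 C0) => t x t1 Fx.
have [k /andP[tk1 tk2]] := geometric_block alpha1 t1.
rewrite invrK [t * _]mulrC; apply: (le_trans (ub k t _ x _)).
  by rewrite -addnS exprD [X in _ <= _ <= X]exprD !ler_pM2l // tk1 ltW.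
rewrite lee_fin ler_pM2l // powR_antitone // log_count_scale //.
have tk : alpha ^+ k <= t <= alpha ^+ k.+1 by rewrite tk1 ltW.
have /andP[_] := log_count_bounds beta1 alpha_beta tk.
have : 1 <= alpha ^+ n.+1 by rewrite exprn_ege1 // ltW.
rewrite -/b -/B -/h; nra.
Qed.

Lemma lower_box_dim_lower_exponent n : lower_exponents F (theta n) b.
Proof.
have [c c0 lb] := covering_number_ge_profile beta1 alpha_beta L0 L1 opt n.+1.
apply: (lower_exponents_intro L0 L1 c0) => t x t1 Fx.
have [k tk] := geometric_block alpha1 t1.
rewrite invrK [t * _]mulrC; apply: le_trans (lb k t _ x Fx tk).
rewrite lee_fin ler_pM2l // powR_antitone // log_count_scale //.
have tk' : alpha ^+ k <= t <= alpha ^+ k.+1 by case/andP: tk => -> /ltW.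
have /andP[+ _] := log_count_bounds beta1 alpha_beta tk'.
have : 1 <= alpha ^+ n.+1 by rewrite exprn_ege1 // ltW.
rewrite -/b -/h; nra.
Qed.

(** Test radius [L `^ u] with [u = beta * alpha ^+ (n.+1 + k)], where the ratio
    [h / u] attains its maximum [B].  Then [t = x * u] is the scale
    [beta * alpha ^+ k] multiplied by [mu = x / theta n], where [h] falls short of
    [B * t] by an amount linear in [|mu - 1|]. *)
Lemma assouad_exponents_cusp n x s :
  theta n / kappa <= x <= theta n * kappa -> assouad_exponents F x s ->
  B + Num.min B (1 - B) * `|x - theta n| <= s.
Proof.
move=> /andP[x1 x2] xs; have [y Fy] := point.
have [k1 kb kba] := kappa_bounds; have k0 : 0 < kappa by apply: lt_trans k1.
have [B0 B1 BE] := upper_box_dim_bounds beta1 alpha_beta.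
rewrite -/B -/b in B0 B1 BE.
pose A := alpha ^+ n.+1; have A0 : 0 < A := alphaX n.+1.
pose mu := x * A.
have xE : x = mu / A by rewrite /mu mulfK ?gt_eqF.
have mu1 : 1 <= mu * kappa.
  by move: x1; rewrite ler_pdivrMr // /theta -[_^-1]div1r ler_pdivrMr // /mu mulrAC.
have mu2 : mu <= kappa by move: x2; rewrite /theta mulrC -/A ler_pdivlMr.
have mu0 : 0 < mu by nra.
have muA : mu < A.
  by apply: le_lt_trans mu2 _; apply: lt_le_trans (alphaX1 n); exact: lt_trans kb _.
have [c c0 lb] := covering_number_ge_profile beta1 alpha_beta L0 L1 opt n.+1.
have tau0 : 0 < beta * mu by exact: mulr_gt0.
pose p := b * alpha + Num.min (beta * mu - beta) 0 - A * (b * alpha).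
have tauE : beta * mu / x = beta * A by rewrite xE; field; rewrite !gt_eqF.
have := @assouad_exponents_ge _ F alpha L x s y c (beta * mu) p
  alpha1 L0 L1 Fy c0 tau0 _ xs.
rewrite tauE => /(_ _) le.
have {le} : (beta * mu - beta * A) * s <= p.
  apply: le => k; have := lb k (beta * mu * alpha ^+ k) (beta * A * alpha ^+ k) y Fy.
  have -> : h k (beta * mu * alpha ^+ k) - h (n.+1 + k)%N (beta * A * alpha ^+ k) =
      p * alpha ^+ k.
    rewrite /p (_ : beta * A * alpha ^+ k = A * (beta * alpha ^+ k)); last by ring.
    rewrite /h log_count_scale // /log_count -/b exprS.
    rewrite [alpha ^+ k * beta]mulrC subrr minxx -mulrBl [(_ - beta) * _]mulrC.
    by rewrite -[X in Num.min _ X](mulr0 (alpha ^+ k)) -minr_pMr ?ltW // -/A; ring.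
  apply; have Ak := alphaX k; rewrite exprS ler_peMl ?ltr_pM2r //=; first nra.
  - by rewrite ltW.
  - by nra.
rewrite /p -BE xE /theta -/A (_ : mu / A - A^-1 = (mu - 1) / A); last by ring.
rewrite normrM [`|A^-1|]gtr0_norm ?invr_gt0 //.
set m := Num.min B (1 - B).
have m0 : 0 <= m by rewrite le_min; apply/andP; split; lra.
move=> le.
suff : m * `|mu - 1| <= (A - mu) * (s - B).
  move=> key; have sB : 0 <= s - B.
    have : 0 <= m * `|mu - 1| by rewrite mulr_ge0.
    by nra.
  have : m * `|mu - 1| <= A * (s - B) by nra.
  by rewrite mulrA -ler_pdivrMl // mulrC; lra.
have mB : m <= B by rewrite ge_min lexx.
have mB' : m <= 1 - B by rewrite ge_min lexx orbT.
have [le1|gt1] := leP mu 1.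
  rewrite ler0_norm ?subr_le0 //.
  move: le; rewrite min_l; last by rewrite subr_le0 ler_piMr // ltW.
  move=> le; have : (mu - A) * s <= B + (mu - 1) - A * B.
    by rewrite -(ler_pM2l beta0); lra.
  by nra.
rewrite gtr0_norm ?subr_gt0 //.
move: le; rewrite min_r; last by rewrite subr_ge0 ler_peMr // ltW.
move=> le; have : (mu - A) * s <= B - A * B by rewrite -(ler_pM2l beta0); lra.
by nra.
Qed.

(** Dually, the test radius is [L `^ u] with [u = alpha ^+ (n.+1 + k)], where
    [h / u] attains its minimum [b]; at [t = x * u] the value of [h] exceeds
    [b * t] by an amount linear in [|mu - 1|]. *)
Lemma lower_exponents_cusp n x s :
  theta n / kappa <= x <= theta n * kappa -> lower_exponents F x s ->
  s <= b - Num.min b (1 - b) * `|x - theta n|.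
Proof.
move=> /andP[x1 x2] xs; have [y Fy] := point.
have [k1 kb kba] := kappa_bounds; have k0 : 0 < kappa by apply: lt_trans k1.
have [b0 b1 bE] := lower_box_dim_bounds beta1 alpha_beta.
rewrite -/b in b0 b1 bE.
pose A := alpha ^+ n.+1; have A0 : 0 < A := alphaX n.+1.
pose mu := x * A.
have xE : x = mu / A by rewrite /mu mulfK ?gt_eqF.
have mu1 : 1 <= mu * kappa.
  by move: x1; rewrite ler_pdivrMr // /theta -[_^-1]div1r ler_pdivrMr // /mu mulrAC.
have mu2 : mu <= kappa by move: x2; rewrite /theta mulrC -/A ler_pdivlMr.
have mu0 : 0 < mu by nra.
have muA : mu < A.
  by apply: le_lt_trans mu2 _; apply: lt_le_trans (alphaX1 n); exact: lt_trans kb _.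
set m := Num.min b (1 - b).
have mb : m <= b by rewrite ge_min lexx.
have mb' : m <= 1 - b by rewrite ge_min lexx orbT.
have m0 : 0 <= m by rewrite le_min; apply/andP; split; lra.
suff key : m * `|mu - 1| <= (A - mu) * (b - s).
  have sb : 0 <= b - s.
    have : 0 <= m * `|mu - 1| by rewrite mulr_ge0.
    by nra.
  have : m * `|mu - 1| <= A * (b - s) by nra.
  rewrite xE /theta -/A (_ : mu / A - A^-1 = (mu - 1) / A); last by ring.
  rewrite normrM [`|A^-1|]gtr0_norm ?invr_gt0 //.
  by rewrite mulrA -ler_pdivrMl // mulrC; lra.
(* For [mu < 1] the larger scale lies in the block preceding [alpha ^+ k]; the
   index is shifted by one so that this block is again numbered [k]. *)
have [lt1|ge1] := ltP mu 1.
  have [c c0 ub] := covering_number_le_profile beta1 alpha_beta L0 L1 opt n.+1.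
  have tau0 : 0 < mu * alpha by exact: mulr_gt0.
  pose p := b * alpha - A * (b * alpha).
  have tauE : mu * alpha / x = A * alpha by rewrite xE; field; rewrite !gt_eqF.
  have := @lower_exponents_le _ F alpha L x s y c (mu * alpha) p
    alpha1 L0 L1 Fy c0 tau0 _ xs.
  rewrite tauE => /(_ _) le.
  have {le} : p <= (mu * alpha - A * alpha) * s.
    apply: le => k.
    have uE : A * alpha * alpha ^+ k = alpha ^+ (n.+2 + k).
      by rewrite exprD [in RHS]exprSr.
    have := ub k (mu * alpha * alpha ^+ k) (A * alpha * alpha ^+ k) y.
    have -> : h k (mu * alpha * alpha ^+ k) - h (n.+2 + k)%N (A * alpha * alpha ^+ k) =
        p * alpha ^+ k.
      rewrite uE exprD /p /h log_count_scale // /log_count -/b exprS.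
      rewrite min_r; last first.
        by rewrite subr_ge0 [leLHS]mulrC ler_pM2r //; nra.
      rewrite min_l; last by rewrite subr_le0 ler_peMr // ltW.
      rewrite [alpha ^+ n.+2]exprSr -/A.
      have -> : alpha ^+ k - alpha ^+ k * beta = - (b * (alpha - 1) * alpha ^+ k).
        by rewrite bE; ring.
      by ring.
    apply; rewrite uE lexx /= ler_eXn2l //.
  rewrite /p => le; rewrite ltr0_norm ?subr_lt0 //.
  have {le} : b - A * b <= (mu - A) * s by rewrite -(ler_pM2r alpha0); lra.
  by nra.
have [c c0 ub] := covering_number_le_profile beta1 alpha_beta L0 L1 opt n.
pose p := b + mu - 1 - A * b.
have tauE : mu / x = A by rewrite xE; field; rewrite !gt_eqF.
have := @lower_exponents_le _ F alpha L x s y c mu p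
  alpha1 L0 L1 Fy c0 mu0 _ xs.
rewrite tauE => /(_ _) le.
have {le} : p <= (mu - A) * s.
  apply: le => k.
  have uE : A * alpha ^+ k = alpha ^+ (n.+1 + k) by rewrite exprD.
  have := ub k (mu * alpha ^+ k) (A * alpha ^+ k) y.
  have -> : h k (mu * alpha ^+ k) - h (n.+1 + k)%N (A * alpha ^+ k) = p * alpha ^+ k.
    rewrite /h log_count_scale // /log_count -/b exprS /p.
    rewrite min_l; last first.
      by rewrite subr_le0 [leRHS]mulrC ler_pM2r //; lra.
    rewrite min_l; last by rewrite subr_le0 ler_peMr // ltW.
    have E : beta = b * (alpha - 1) + 1 by lra.
    by rewrite -/A E; ring.
  apply; rewrite uE lexx /= ler_eXn2l //.
rewrite /p => le; rewrite ger0_norm ?subr_ge0 //.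
by nra.
Qed.

Lemma spectra_cusps :
  (forall n x, theta n / kappa <= x <= theta n * kappa ->
     assouad_spectrum F (theta n) + Num.min B (1 - B) * `|x - theta n| <=
     assouad_spectrum F x) /\
  (forall n x, theta n / kappa <= x <= theta n * kappa ->
     lower_spectrum F x <=
     lower_spectrum F (theta n) - Num.min b (1 - b) * `|x - theta n|).
Proof.
have [k1 kb _] := kappa_bounds; have k0 : 0 < kappa by apply: lt_trans k1.
have self n : theta n / kappa <= theta n <= theta n * kappa.
  by rewrite ler_pdivrMr // ler_pMr // ltW.
split=> n x xI.
- have x0 : 0 < x by case/andP: xI => /(lt_le_trans _) -> //; rewrite divr_gt0.
  have x1 : x < 1 by case/andP: xI => _ /theta_lt1.
  apply: (@le_trans _ _ (B + Num.min B (1 - B) * `|x - theta n|)).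
    rewrite lerD2r; apply: ge_inf; last exact: upper_box_dim_assouad_exponent.
    exists (B + Num.min B (1 - B) * `|theta n - theta n|) => s sE.
    exact: assouad_exponents_cusp (self n) sE.
  apply: lb_le_inf; first by exists 1; exact: assouad_exponents1 L0 L1 x0 x1.
  by move=> s sE; exact: assouad_exponents_cusp xI sE.
- apply: (@le_trans _ _ (b - Num.min b (1 - b) * `|x - theta n|)).
    apply: ge_sup; first by exists 0; exact: lower_exponents0 L0 L1.
    by move=> s sE; exact: lower_exponents_cusp xI sE.
  rewrite lerD2r; apply: ub_le_sup; last exact: lower_box_dim_lower_exponent.
  exists (b - Num.min b (1 - b) * `|theta n - theta n|) => s sE.
  exact: lower_exponents_cusp (self n) sE.
Qed.

Lemma assouad_spectrum_irregular :
  irregular (assouad_spectrum F).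
Proof.
have [k1 _ _] := kappa_bounds.
have [B0 B1 _] := upper_box_dim_bounds beta1 alpha_beta.
apply: (geometric_cusps_irregular k1 kappa_sqr _ spectra_cusps.1).
by rewrite lt_min B0 subr_gt0.
Qed.

Lemma lower_spectrum_irregular :
  irregular (lower_spectrum F).
Proof.
have [k1 _ _] := kappa_bounds.
have [b0 b1 _] := lower_box_dim_bounds beta1 alpha_beta.
have c0 : 0 < Num.min b (1 - b) by rewrite lt_min b0 subr_gt0.
pose g x := - lower_spectrum F x.
have opp_mono J : monotonic_on J (lower_spectrum F) ->
    monotonic_on J g.
  by case=> mono; [right|left] => x y xJ yJ xy; rewrite lerN2; exact: mono.
have [|nomono [J [J01 Jdisj Jno]] nodiff] := geometric_cusps_irregular
    (g := g) k1 kappa_sqr c0.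
  move=> n x xI; rewrite /g -[leLHS]opprK opprD opprK lerN2.
  exact: spectra_cusps.2 n x xI.
split; first by move/opp_mono.
  by exists J; split=> // n /opp_mono; exact: Jno.
apply: sub_infinite_set nodiff => x [x01 nd]; split; first exact: x01.
by move=> d; exact: nd (derivableN d).
Qed.

End Spectra.

Theorem corollary8p3 (R : realType) (alpha beta L a : R) (F : set R)
    (hbeta : 1 < beta) (halpha : beta < alpha)
    (hL0 : 0 < L) (hL1 : L < 1)
    (hF : is_F_alpha_beta alpha beta L a F) :
  forall f : R -> R, f = assouad_spectrum F \/ f = lower_spectrum F ->
    [/\ ~ monotonic_on `]0, 1[%R f,
        exists J : nat -> interval R,
          [/\ forall n, [set` J n] `<=` `]0, 1[%classic,
              trivIset setT (fun n => [set` J n]) &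
              forall n, ~ monotonic_on (J n) f] &
        infinite_set [set theta | 0 < theta < 1 /\ ~ derivable f theta 1]].
Proof.
have [pack [opt ->]] := hF.
move=> f [->|->]; first exact: assouad_spectrum_irregular hbeta halpha hL0 hL1 opt.
exact: lower_spectrum_irregular hbeta halpha hL0 hL1 opt.
Qed.
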